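(* Let $F:\mathbb{R}^N\to\mathbb{R}^N$ and $H:\mathbb{R}^N\to\mathbb{R}^M$ be of class $C^1$ with $F(0)=0$ and $H(0)=0$. Let $\lambda:\mathbb{R}^N\to\mathbb{C}$ of class $C^0$ and $v:\mathbb{R}^N\to\mathbb{C}^N\setminus\{0_{N\times 1}\}$ of class $C^1$ be, respectively, a nonlinear left eigenvalue and its associated nonlinear left eigenvector of $\dot z=F(z)$ on $\mathbb{R}^N$. If $q:\mathbb{R}^N\times\mathbb{R}^M\to\mathbb{R}^N$ of class $C^1$ with $q(0,0)=0$ satisfies $$v^\top(z)\frac{\partial q(z,H(z))}{\partial z}+\left(\frac{\partial v(z)}{\partial z}q(z,H(z))\right)^\top=0$$ for all $z\in\mathbb{R}^N$, where $\frac{\partial q(z,H(z))}{\partial z}$ denotes the Jacobian of the composite map $z\mapsto q(z,H(z))$, then $\lambda(z)$ and $v(z)$ are, respectively, a nonlinear left eigenvalue and its associated nonlinear left eigenvector of the system $\dot z=F(z)+q(z,H(z))$ on $\mathbb{R}^N$.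
   Context: Definition (nonlinear left eigenvalue/eigenvector). Let $s:\mathbb{R}^d\to\mathbb{R}^d$ be of class $C^1$ with $s(0)=0$ and let $D\subseteq\mathbb{R}^d$. A class $C^0$ function $\lambda:D\to\mathbb{C}$ and a class $C^1$ function $v:D\to\mathbb{C}^d\setminus\{0_{d\times 1}\}$ are called, respectively, a nonlinear left eigenvalue and an associated nonlinear left eigenvector of $\dot w=s(w)$ on $D$ if $$v^\top(w)\frac{\partial s(w)}{\partial w}+\left(\frac{\partial v(w)}{\partial w}s(w)\right)^\top=\lambda(w)v^\top(w)$$ for all $w\in D$. Here $^\top$ denotes the (non-conjugate) transpose. *)

(* Defs.v *)
From HB Require Import structures.
From mathcomp Require Import all_boot all_order all_algebra.
From mathcomp Require Import all_classical all_reals all_analysis.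
From mathcomp.real_closed Require Export complex.

Set Implicit Arguments.
Unset Strict Implicit.
Unset Printing Implicit Defensive.

Import Order.TTheory GRing.Theory Num.Theory.
Import numFieldNormedType.Exports.

Local Open Scope classical_set_scope.
Local Open Scope ring_scope.

(* Meant for finite-dimensional V, where continuity of x |-> 'd f x h for every
   fixed direction h is the same as continuity of x |-> 'd f x in operator
   norm, and as continuity of all partial derivatives.  Functions are total on
   V and differentiability is taken in V, so for an open D (in particular for
   setT) this is the usual notion of a C^1 function on D. *)
Definition class_C1 (R : realType) (V W : normedModType R) (D : set V)
    (f : V -> W) : Prop :=
  (forall x, D x -> differentiable f x) /\
  (forall h : V, {within D, continuous (fun x => 'd f x h)}).

(* The m x n Jacobian matrix acting on column vectors; the library's 'J acts on
   row vectors from the right and is therefore the transpose convention. *)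
Definition jac (R : realType) (n m : nat) (f : 'cV[R]_n -> 'cV[R]_m)
    (x : 'cV[R]_n) : 'M[R]_(m, n) :=
  \matrix_(i, j) ('D_(delta_mx j 0) f x) i 0.

Lemma jac_mulE (R : realType) (n m : nat) (f : 'cV[R]_n -> 'cV[R]_m)
    (x h : 'cV[R]_n) :
  differentiable f x -> jac f x *m h = 'd f x h.
Proof.
move=> df; have hE : h = \sum_j h j 0 *: delta_mx j 0.
  by rewrite {1}(matrix_sum_delta h); apply: eq_bigr => j _; rewrite big_ord1.
rewrite [in RHS]hE linear_sum; apply/matrixP => i k.
rewrite (ord1 k) mxE summxE; apply: eq_bigr => j _.
by rewrite linearZ !mxE (deriveE _ df) mulrC.
Qed.

Definition cmx (R : realType) (m n : nat) (A : 'M[R]_(m, n)) :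
    'M[R[i]]_(m, n) :=
  map_mx (real_complex R) A.

Definition re_part (R : realType) (n m : nat) (v : 'cV[R]_n -> 'cV[R[i]]_m)
    (x : 'cV[R]_n) : 'cV[R]_m :=
  map_mx (@complex.Re R) (v x).

Definition im_part (R : realType) (n m : nat) (v : 'cV[R]_n -> 'cV[R[i]]_m)
    (x : 'cV[R]_n) : 'cV[R]_m :=
  map_mx (@complex.Im R) (v x).

(* Differentiation of a C^m-valued function of a real variable is real
   differentiation, C^m being identified with R^m x R^m. *)
Definition cclass_C1 (R : realType) (n m : nat) (D : set 'cV[R]_n)
    (v : 'cV[R]_n -> 'cV[R[i]]_m) : Prop :=
  class_C1 D (re_part v) /\ class_C1 D (im_part v).

Definition cjac (R : realType) (n m : nat) (v : 'cV[R]_n -> 'cV[R[i]]_m)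
    (x : 'cV[R]_n) : 'M[R[i]]_(m, n) :=
  \matrix_(i, j) Complex (jac (re_part v) x i j) (jac (im_part v) x i j).

(* lam is a nonlinear left eigenvalue of w' = s(w) on D, and v an associated
   nonlinear left eigenvector; the requirements on s itself are included.
   R[i]^o carries the topology of the complex modulus. *)
Definition nonlinear_left_eigenpair (R : realType) (d : nat)
    (s : 'cV[R]_d -> 'cV[R]_d) (D : set 'cV[R]_d)
    (lam : 'cV[R]_d -> R[i]) (v : 'cV[R]_d -> 'cV[R[i]]_d) : Prop :=
  (class_C1 setT s /\ s 0 = 0) /\
  [/\ {within D, continuous (lam : 'cV[R]_d -> R[i]^o)},
      cclass_C1 D v,
      forall w, D w -> v w != 0
    & forall w, D w ->
        (v w)^T *m cmx (jac s w) + (cjac v w *m cmx (s w))^T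
        = lam w *: (v w)^T].

(* Main.v *)
(* The left-hand side is additive in the vector field, so the equation for F + q(., H)
   is the sum of the two given equations.  What remains is that the composite
   z |-> q(z, H z) is of class C^1: by the chain rule its derivative along h at
   z is 'd q (z, H z) (h, 'd H z h), whose second argument moves with z, and
   expanding it in the canonical basis reduces continuity to that of the
   derivatives of q in fixed directions. *)
Require Import Defs.
From mathcomp Require Import all_boot all_order all_algebra.
From mathcomp Require Import all_classical all_reals all_analysis.
Import GRing.Theory numFieldNormedType.Exports.
Local Open Scope classical_set_scope.
Local Open Scope ring_scope.

(** Continuity in each fixed direction does not at once give continuity along a moving one. For a
    finite combination of fixed vectors with continuous coefficients, linearity of each [L x] turns
    the value into a finite sum of products of continuous maps. *)
Lemma linear_apply_sum_continuous (R : realType) (T : topologicalType)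
    (U W : normedModType R) (n : nat) (L : T -> {linear U -> W})
    (c : 'I_n -> T -> R) (u : 'I_n -> U) :
  (forall j, continuous (fun x => L x (u j))) -> (forall j, continuous (c j)) ->
  continuous (fun x => L x (\sum_j c j x *: u j)).
Proof.
move=> Lc cc.
have -> : (fun x => L x (\sum_j c j x *: u j)) =
    \sum_j (fun x => c j x *: L x (u j)).
  apply/funext => x; rewrite fct_sumE linear_sum.
  by apply: eq_bigr => j _; rewrite linearZ.
elim/big_ind: _ => [x|f g fc gc x|j _ x]; first exact: cvg_cst.
  by apply: continuousD; [exact: fc|exact: gc].
by apply: cvgZ; [exact: cc|exact: Lc].
Qed.

Lemma class_C1_diff_continuous (R : realType) (V W : normedModType R)
    (f : V -> W) (h : V) :
  class_C1 setT f -> continuous (fun x => 'd f x h).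
Proof. by move=> [_ cf]; apply/continuous_subspace_setT; exact: cf. Qed.

Lemma class_C1D (R : realType) (V W : normedModType R) (f g : V -> W) :
  class_C1 setT f -> class_C1 setT g -> class_C1 setT (f + g).
Proof.
move=> fC1 gC1; have [[df _] [dg _]] := (fC1, gC1); split=> [x _|h].
  by apply: differentiableD; [exact: df|exact: dg].
apply: continuous_subspaceT.
have -> : (fun x => 'd (f + g) x h) =
    (fun x => 'd f x h) + (fun x => 'd g x h).
  by apply/funext => x; rewrite diffD //; [exact: df|exact: dg].
by move=> x; apply: continuousD; exact: class_C1_diff_continuous.
Qed.

Lemma class_C1_comp_graph (R : realType) (V W : normedModType R) (m : nat)
    (H : V -> 'cV[R]_m) (q : V * 'cV[R]_m -> W) :
  class_C1 setT H -> class_C1 setT q -> class_C1 setT (fun z => q (z, H z)).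
Proof.
move=> HC1 qC1; have [[dH _] [dq _]] := (HC1, qC1).
have dG z : differentiable (fun y => (y, H y)) z.
  by apply: differentiable_pair => //; exact: dH.
split=> [z _|h].
  by apply: (differentiable_comp (dG z)); exact: dq.
apply: continuous_subspaceT.
(* For a fixed direction [u], the derivative of [q] is merely composed with the graph map of [H],
   which is continuous because it is differentiable. *)
have cqG u : continuous (fun z => 'd q (z, H z) u).
  move=> z; apply: (@continuous_comp _ _ _ (fun y => (y, H y))
    (fun p => 'd q p u)); first exact: differentiable_continuous.
  exact: (@class_C1_diff_continuous _ _ _ q u qC1 (z, H z)).
(* The direction [(h, 'd H z h)] splits into the constant [(h, 0)] and [(0, 'd H z h)]; only the
   coefficients of the latter along the vectors [(0, delta_mx j 0)] depend on [z]. *)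
have -> : (fun z => 'd (fun y => q (y, H y)) z h) =
    (fun z => 'd q (z, H z) (h, 0)) + (fun z => 'd q (z, H z)
      (\sum_j ('d H z h) j 0 *: ((0, delta_mx j 0) : V * 'cV[R]_m))).
  apply/funext => z.
  rewrite (@diff_comp _ _ _ _ _ q _ (dG z) (dq _ I)) /= diff_pair //;
    last exact: dH.
  rewrite (diff_val (is_diff_def := is_diff_id z)) /=.
  rewrite -[RHS](linearD ('d q (z, H z))); congr ('d q _ _).
  (* Both projections commute with the sum: the first gives a sum of zeros, the second the canonical
     expansion of ['d H z h]. *)
  rewrite [X in _ + X]surjective_pairing !raddf_sum /=.
  rewrite big1 => [|j _]; last by rewrite scaler0.
  congr pair; rewrite /= ?addr0 // add0r [LHS]matrix_sum_delta.
  by apply: eq_bigr => j _; rewrite big_ord1.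
move=> z; apply: continuousD; first exact: cqG.
apply: linear_apply_sum_continuous => [j|j y]; first exact: cqG.
apply: (@continuous_comp _ _ _ (fun z => 'd H z h) (fun A => A j 0)).
  exact: (@class_C1_diff_continuous _ _ _ H h HC1 y).
exact: coord_continuous.
Qed.

Lemma jacD (R : realType) (n m : nat) (f g : 'cV[R]_n -> 'cV[R]_m) x :
  differentiable f x -> differentiable g x ->
  jac (f + g) x = jac f x + jac g x.
Proof.
move=> df dg; apply/matrixP => i j.
by rewrite !mxE deriveD ?mxE //; exact: diff_derivable.
Qed.

Theorem theorem4 (R : realType) (N M : nat)
    (F : 'cV[R]_N -> 'cV[R]_N) (H : 'cV[R]_N -> 'cV[R]_M)
    (F_C1 : class_C1 setT F) (H_C1 : class_C1 setT H)
    (F0 : F 0 = 0) (H0 : H 0 = 0)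
    (lam : 'cV[R]_N -> R[i]) (v : 'cV[R]_N -> 'cV[R[i]]_N)
    (lam_v_F : nonlinear_left_eigenpair F setT lam v)
    (q : 'cV[R]_N * 'cV[R]_M -> 'cV[R]_N)
    (q_C1 : class_C1 setT q) (q0 : q (0, 0) = 0)
    (hq : forall z : 'cV[R]_N,
       (v z)^T *m cmx (jac (fun y => q (y, H y)) z)
       + (cjac v z *m cmx (q (z, H z)))^T = 0) :
  nonlinear_left_eigenpair (fun z => F z + q (z, H z)) setT lam v.
Proof.
have [[_ _] [lamC vC1 v0 eigF]] := lam_v_F.
have QC1 : class_C1 setT (fun z => q (z, H z)) by exact: class_C1_comp_graph.
split; first by split; [exact: class_C1D|rewrite F0 H0 q0 addr0].
split=> [|||w _]; [exact: lamC|exact: vC1|exact: v0|].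
rewrite -[fun z => _]/(F + (fun z => q (z, H z))).
rewrite jacD; [|exact: F_C1.1|exact: QC1.1].
(* The entrywise embedding into [R[i]], the matrix product and transposition are all additive;
   [addrACA] then groups the terms of [F] apart from those of [q]. *)
rewrite /cmx !map_mxD !mulmxDr linearD /= addrACA.
by rewrite (eigF w I) hq addr0.
Qed.
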